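(* Let $\mathcal{F}=\langle E,H,\sim\rangle$ be an ETL frame (a single tree) in which $\sim$ is transitive and Euclidean. Then $\mathcal{F}$ has $\mathsf{PR}$ (that is, both $\mathsf{PR_{ee}}$ and $\mathsf{PR_{hc}^\ell}$) if and only if $\mathcal{F}$ has $\mathsf{PR_{hc}^\ell}$.
   Context: Fix a finite set $E$ of events; histories are finite sequences of events, $\epsilon$ the empty history. Write $h\leadsto h'$ if $h'=he$ for some event $e$. A protocol $H$ is a finite prefix-closed set of histories (it forms a tree rooted at $\epsilon$ under $\leadsto$). An ETL frame is $\langle E,H,\sim\rangle$ with $\sim\subseteq H\times H$ not necessarily reflexive or symmetric. $[h]_\sim=\{h':h\sim h'\}$. Euclidean: $h\sim h'$ and $h\sim h''$ imply $h'\sim h''$. $\mathrm{EE}(e_1\dots e_\ell)$ is the sequence $[\epsilon]_\sim,[e_1]_\sim,\dots,[e_1\dots e_\ell]_\sim$; $\mathrm{EE}(h)\approx\mathrm{EE}(h')$ iff equal after collapsing consecutive repeated sets. $\mathsf{PR_{ee}}$: $h\sim h'$ implies $\mathrm{EE}(h)\approx\mathrm{EE}(h')$. $\mathsf{PR_{hc}^\ell}$: for all $h,h'$ and events $e$ with $he\sim h'$: (i) $h\sim h'$, or (ii) $h\sim h''\leadsto h'$ for some $h''$, or (iii) $he\sim h''\leadsto h'$ for some $h''$. *)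

(* Defs.v *)
From mathcomp Require Import all_boot.
From mathcomp Require Import finmap.
Set Implicit Arguments.
Unset Strict Implicit.
Unset Printing Implicit Defensive.

(* Mathematical Components.  Histories over the event set [E] are lists in
   chronological order: [e_1 ... e_l] is [:: e_1; ..; e_l], the empty history
   is [::], and [h e] is [rcons h e]. *)

Definition leadsto (E : finType) (h h' : seq E) : Prop :=
  exists e : E, h' = rcons h e.

(* [sim] is boolean-valued so that information sets are finite sets with
   decidable equality; as [sim] is a relation on a finite protocol, this is no
   restriction on frames.  Given prefix closure, [protocol_root] only excludes
   the empty protocol, which is not a tree rooted at the empty history. *)
Record ETL_frame (E : finType) := ETLFrame {
  protocol : {fset seq E};
  protocol_root : [::] \in protocol;
  protocol_prefix_closed : forall h h' : seq E,
    prefix h h' -> h' \in protocol -> h \in protocol;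
  sim : rel (seq E);
  sim_protocol : forall h h' : seq E,
    sim h h' -> h \in protocol /\ h' \in protocol
}.

Definition info_set (E : finType) (F : ETL_frame E) (h : seq E) :
    {fset seq E} :=
  [fset h' in protocol F | sim F h h']%fset.

Definition euclidean (T : Type) (R : rel T) : Prop :=
  forall x y z : T, R x y -> R x z -> R y z.

Fixpoint collapse (T : eqType) (s : seq T) : seq T :=
  if s is x :: s' then
    if s' is y :: _ then if x == y then collapse s' else x :: collapse s'
    else [:: x]
  else [::].

Definition EE (E : finType) (F : ETL_frame E) (h : seq E) :
    seq {fset seq E} :=
  [seq info_set F (take i h) | i <- iota 0 (size h).+1].

Definition EE_equiv (E : finType) (F : ETL_frame E) (h h' : seq E) : Prop :=
  collapse (EE F h) = collapse (EE F h').

Definition PR_ee (E : finType) (F : ETL_frame E) : Prop :=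
  forall h h' : seq E, sim F h h' -> EE_equiv F h h'.

(* Histories need not be restricted to the protocol here: [sim] does so, and
   [h] is a prefix of [rcons h e]. *)
Definition PR_hcl (E : finType) (F : ETL_frame E) : Prop :=
  forall (h h' : seq E) (e : E), sim F (rcons h e) h' ->
    [\/ sim F h h',
        exists2 h'' : seq E, sim F h h'' & leadsto h'' h'
      | exists2 h'' : seq E, sim F (rcons h e) h'' & leadsto h'' h'].

Definition PR (E : finType) (F : ETL_frame E) : Prop :=
  PR_ee F /\ PR_hcl F.

(* Main.v *)
Require Import Defs.
From mathcomp Require Import all_boot.
From mathcomp Require Import finmap.
Set Implicit Arguments.
Unset Strict Implicit.
Unset Printing Implicit Defensive.

(* Related histories have the same information set, so [PR_hcl] yields [PR_ee]
   by induction on the two lengths: each of its three alternatives shortens one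
   or both histories.  The exception is a pair [epsilon ~ h], about which
   [PR_hcl] says nothing.  There, [h] is reflexive by Euclideanness, and the
   maximal run of reflexive prefixes ending in [h] starts at some [x].  As the
   parent of [x], if any, is not reflexive, only the first alternative can hold
   for a history related to [x], so all prefixes of such a history are related
   to [x].  Applied to [x] this gives [epsilon ~ x], whence [h ~ x], and applied
   to [h] it shows that the information set is constant along [h]. *)

(** [collapse] recurses from the front, but histories grow at the end. *)
Lemma collapse_rcons2 (T : eqType) (s : seq T) (x y : T) :
  collapse (rcons (rcons s x) y) =
    if x == y then collapse (rcons s x) else rcons (collapse (rcons s x)) y.
Proof.
elim: s => [|a s IHs] /=.
  by case: eqP => [->|].
case: s IHs => [|b s] /= IHs; last by rewrite IHs; do 2!case: ifP.
by rewrite IHs; do 2!case: ifP.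
Qed.

Lemma EE_rcons (E : finType) (F : ETL_frame E) (h : seq E) (e : E) :
  EE F (rcons h e) = rcons (EE F h) (info_set F (rcons h e)).
Proof.
rewrite /EE size_rcons -[(size h).+2]addn1 iotaD map_cat cats1 add0n.
rewrite -(size_rcons h e) take_size size_rcons; congr rcons.
apply/eq_in_map => i; rewrite mem_iota ltnS => /= le_i_h.
by rewrite -cats1 takel_cat.
Qed.

Lemma EE_last (E : finType) (F : ETL_frame E) (h : seq E) :
  exists s, EE F h = rcons s (info_set F h).
Proof.
case/lastP: h => [|h e]; first by exists [::].
by exists (EE F h); exact: EE_rcons.
Qed.

Lemma collapse_EE_rcons (E : finType) (F : ETL_frame E) (h : seq E) (e : E) :
  collapse (EE F (rcons h e)) =
    if info_set F h == info_set F (rcons h e) then collapse (EE F h)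
    else rcons (collapse (EE F h)) (info_set F (rcons h e)).
Proof.
by rewrite EE_rcons; have [s ->] := EE_last F h; exact: collapse_rcons2.
Qed.

Lemma EE_equiv_rcons (E : finType) (F : ETL_frame E) (h : seq E) (e : E) :
  info_set F h = info_set F (rcons h e) -> EE_equiv F (rcons h e) h.
Proof. by move=> eq_h; rewrite /EE_equiv collapse_EE_rcons eq_h eqxx. Qed.

Lemma sim_info_set (E : finType) (F : ETL_frame E) (h h' : seq E) :
  transitive (sim F) -> euclidean (sim F) -> sim F h h' ->
  info_set F h = info_set F h'.
Proof.
move=> sim_trans sim_eucl hh'; apply/fsetP => k; rewrite !inE /=.
congr (_ && _); apply/idP/idP; first exact: sim_eucl.
exact: sim_trans.
Qed.

Definition reflexive_start (T : Type) (R : rel (seq T)) (x : seq T) : Prop :=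
  R x x /\ forall k e, x = rcons k e -> ~~ R k k.

Lemma reflexive_start_exists (T : Type) (R : rel (seq T)) (h : seq T) :
  R h h -> exists x, reflexive_start R x.
Proof.
elim/last_ind: h => [|h e IHh] Rh.
  by exists [::]; split=> // k e /(congr1 size); rewrite size_rcons.
case: (boolP (R h h)) => [/IHh //|nRh].
by exists (rcons h e); split=> // k e' /rcons_inj[<-].
Qed.

Lemma sim_reflexive_start (E : finType) (F : ETL_frame E) (x h : seq E) :
  transitive (sim F) -> euclidean (sim F) -> PR_hcl F ->
  reflexive_start (sim F) x -> sim F h x ->
  sim F [::] x /\ EE_equiv F [::] h.
Proof.
move=> sim_trans sim_eucl hcl [_ parent_irr].
elim/last_ind: h => [|h e IHh] hx; first by [].
have kx: sim F h x.
  (* Either other alternative relates some history to the parent [k] of [x], and Euclideanness then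
     makes [k] reflexive. *)
  case: (hcl _ _ _ hx) => // -[k hk [e' /parent_irr/negP[]]];
    exact: (sim_eucl _ _ _ hk hk).
have [root_x eqEE] := IHh kx; split=> //.
rewrite /EE_equiv eqEE; symmetry; apply: EE_equiv_rcons.
by rewrite (sim_info_set sim_trans sim_eucl kx)
           (sim_info_set sim_trans sim_eucl hx).
Qed.

Lemma PR_hcl_ee (E : finType) (F : ETL_frame E) :
  transitive (sim F) -> euclidean (sim F) -> PR_hcl F -> PR_ee F.
Proof.
move=> sim_trans sim_eucl hcl.
have info h h' : sim F h h' -> info_set F h = info_set F h'.
  exact: sim_info_set.
elim/last_ind => [|h e IHh] h'.
  move=> root_h'; have h'h' := sim_eucl _ _ _ root_h' root_h'.
  have [x x_start] := reflexive_start_exists h'h'.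
  have [root_x _] :=
    sim_reflexive_start sim_trans sim_eucl hcl x_start x_start.1.
  apply: (sim_reflexive_start sim_trans sim_eucl hcl x_start _).2.
  exact: sim_eucl root_h' root_x.
elim/last_ind: h' => [|h' e' IHh'] heh'.
  (* The empty history has no parent, so only the first alternative survives. *)
  case: (hcl _ _ _ heh') => [hh'|[k _ [d]]|[k _ [d]]];
    try by move/(congr1 size); rewrite size_rcons.
  rewrite /EE_equiv -(IHh _ hh'); apply: EE_equiv_rcons.
  by rewrite (info _ _ hh') (info _ _ heh').
case: (hcl _ _ _ heh') =>
  [hh'|[k hk [d /rcons_inj[eqk _]]]|[k hek [d /rcons_inj[eqk _]]]].
- rewrite /EE_equiv -(IHh _ hh'); apply: EE_equiv_rcons.
  by rewrite (info _ _ hh') (info _ _ heh').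
(* The parents share an information set, and so do the full histories: both sequences grow or
   neither does. *)
- rewrite -eqk in hk.
  by rewrite /EE_equiv !collapse_EE_rcons (IHh _ hk) (info _ _ hk)
             (info _ _ heh').
(* Only the second history shrinks, and its last step repeats an information set. *)
rewrite -eqk in hek.
rewrite /EE_equiv (IHh' hek); symmetry; apply: EE_equiv_rcons.
by rewrite -(info _ _ hek) (info _ _ heh').
Qed.

Theorem theorem2 (E : finType) (F : ETL_frame E)
    (sim_trans : transitive (sim F)) (sim_eucl : euclidean (sim F)) :
  PR F <-> PR_hcl F.
Proof.
by split=> [[]//|hcl]; split=> //; exact: PR_hcl_ee.
Qed.
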